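(* Let $p\ge 2$ and $m\ge 1$ be integers, $\tau>0$, and $\alpha>1$ with $\alpha m/p$ an integer. Let $X_1,\dots,X_p$ be i.i.d. nonnegative random variables (the initial delays of the $p$ workers), with order statistics $X_{1:p}\le\dots\le X_{p:p}$, and let $U_l = X_{l+1:p}-X_{l:p}$ for $l=1,\dots,p-1$. Let $T_{\text{LT}}$ and $T_{\text{ideal}}$ be the latencies, for the same realization of $X_1,\dots,X_p$, of the rateless (LT) coded strategy with redundancy $\alpha$ and of the ideal load balancing strategy, respectively. Then $$\Pr(T_{\text{LT}} > T_{\text{ideal}}) \le \sum_{j=2}^{p}\Pr\left(\sum_{l=1}^{j-1}U_{l} \ge \frac{\tau m(\alpha - 1)}{p - 1}\right).$$
   Context: Setting: a matrix with $m$ rows is multiplied by a vector using $p$ workers. Delay model: worker $i$ has a random initial delay $X_i$, after which it performs row-vector product tasks one after the other, each taking time $\tau$; so it needs time $X_i+\tau b$ to complete $b$ tasks. Thus a worker that never runs out of tasks has completed $N_i(t)=\max(0,\lfloor (t-X_i)/\tau\rfloor)$ tasks by time $t$. Ideal load balancing: the $m$ tasks are kept in a central queue and each worker is given a new task as soon as it becomes available; the latency is the time at which $m$ tasks have been completed in total, i.e. $T_{\text{ideal}}=\min\{t:\sum_{i=1}^p N_i(t)\ge m\}$. Rateless (LT) coded strategy with redundancy $\alpha$: $m_e=\alpha m$ encoded rows are generated and divided equally among the $p$ workers, so each worker can complete at most $\alpha m/p$ tasks and is idle after that. The result can be decoded once the workers have collectively completed $M'$ tasks, where the decoding threshold $M'$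 is taken to be equal to $m$. Hence $T_{\text{LT}}=\min\{t:\sum_{i=1}^p \min(\alpha m/p,\,N_i(t))\ge m\}$. *)

(* Defs.v *)
From HB Require Import structures.
From mathcomp Require Import all_boot all_order all_algebra.
From mathcomp Require Import all_classical all_reals all_analysis.

Set Implicit Arguments.
Unset Strict Implicit.
Unset Printing Implicit Defensive.

Import Order.TTheory GRing.Theory Num.Theory.

Local Open Scope classical_set_scope.
Local Open Scope ring_scope.

Section iid.
Context (d : measure_display) (T : measurableType d) (R : realType)
  (P : probability T R) (I : finType).
Implicit Type X : I -> {RV P >-> R}.

Definition mutually_independent X : Prop :=
  forall (J : {set I}) (A : I -> set R),
    (forall i, i \in J -> measurable (A i)) ->
    P (\bigcap_(i in [set j | j \in J]) (X i @^-1` A i)) =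
    (\prod_(i in J) P (X i @^-1` A i))%E.

(* Only measurable sets are compared: the value of a measure outside the
   sigma-algebra is meaningless. *)
Definition identically_distributed X : Prop :=
  forall (i j : I) (A : set R), measurable A ->
    distribution P (X i) A = distribution P (X j) A.

Definition iid X : Prop := mutually_independent X /\ identically_distributed X.

End iid.

Section order_statistics.
Context (R : realType) (p : nat).
Implicit Type x : 'I_p -> R.

(* [order_stat x k] is x_{k:p}, with k counted from 1. *)
Definition order_stat x (k : nat) : R :=
  nth 0 (sort <=%R [seq x i | i : 'I_p]) k.-1.

Definition spacing x (l : nat) : R := order_stat x l.+1 - order_stat x l.

End order_statistics.

Section latency.
Context (R : realType) (p : nat).
Implicit Types (tau t alpha : R) (x : 'I_p -> R) (m : nat).

(* The least element of A; the value 0 is used when A has none. *)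
Definition minimum (A : set R) : R := xget 0 (A `&` lbound A).

(* Tasks completed by time t by a worker with initial delay x0 that never runs
   out of tasks. *)
Definition completed tau (x0 t : R) : int :=
  Num.max 0 (Num.floor ((t - x0) / tau)).

Definition T_ideal tau m x : R :=
  minimum [set t | m%:Z <= \sum_(i < p) completed tau (x i) t].

(* The cap alpha * m / p is the number of encoded rows held by one worker;
   decoding is possible once m products have been completed. *)
Definition T_LT tau alpha m x : R :=
  minimum [set t | m%:R <= \sum_(i < p)
    Num.min (alpha * m%:R / p%:R) (completed tau (x i) t)%:~R].

End latency.

(* Main.v *)
Require Import Defs.
From HB Require Import structures.
From mathcomp Require Import all_boot all_order all_algebra.
From mathcomp Require Import all_classical all_reals all_analysis.
From mathcomp Require Import measurable_realfun ring lra.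

Import Order.TTheory GRing.Theory Num.Theory.

Local Open Scope classical_set_scope.
Local Open Scope ring_scope.

(* Let t be the ideal latency. If the LT latency is larger, some worker i has
   completed more than c = alpha m / p tasks at time t, so X_i <= t - (c + 1) tau.
   If no delay exceeded X_i by D = tau (p c - m) / (p - 1) or more, then just
   before t worker i would have completed at least c tasks and every other worker
   at least c - D / tau, which is m in total, contradicting the minimality of t.
   Hence the range of the delays, which is the sum of all spacings, is at least
   D = tau m (alpha - 1) / (p - 1). *)

Lemma minimumP (R : realType) (A : set R) (t : R) :
  A t -> lbound A t -> A (minimum A) /\ lbound A (minimum A).
Proof.
move=> At lbt; suff [] : (A `&` lbound A) (minimum A) by [].
by apply: xgetPex; exists t.
Qed.

Lemma measurable_fun_sublevel d (T : measurableType d) (R : realType)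
    (f : T -> R) :
  (forall t, measurable [set w | f w <= t]) -> measurable_fun setT f.
Proof.
move=> mf; apply: (measurability (@RGenOInfty.G R)).
  exact: RGenOInfty.measurableE.
move=> _ [_ [t ->] <-]; rewrite setTI.
have -> : f @^-1` `]t, +oo[ = ~` [set w | f w <= t].
  by apply/seteqP; split=> w /=; rewrite in_itv/= andbT ltNge => /negP.
exact: measurableC.
Qed.

(** * Task counts as step functions of time *)

Section completed_tasks.
Context (R : realType) (tau : R).
Hypothesis tau_gt0 : 0 < tau.

Lemma completed_homo (x y t u : R) :
  y <= x -> t <= u -> completed tau x t <= completed tau y u.
Proof.
move=> yx tu; rewrite /completed ge_max le_max lexx /= le_max.
by rewrite le_floor ?orbT// ler_pM2r ?invr_gt0// lerB.
Qed.

Lemma completed_ge (x t : R) (n : int) :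
  x + n%:~R * tau <= t -> n <= completed tau x t.
Proof.
by move=> h; rewrite le_max floor_ge_int ler_pdivlMr// lerBrDl h orbT.
Qed.

(** For [0 < n] only the floor, not the truncation at 0, can reach [n]. *)
Lemma completed_le (x t : R) (n : int) :
  0 < n -> n <= completed tau x t -> x + n%:~R * tau <= t.
Proof.
by move=> n0; rewrite le_max leNgt n0 floor_ge_int ler_pdivlMr// lerBrDl.
Qed.

(** Right-continuity of the count: it stays constant until the floor next jumps. This is what makes
    the latency an attained minimum. *)
Lemma completed_rcont (x u : R) :
  exists2 v, u < v & forall t, u <= t < v ->
    completed tau x t = completed tau x u.
Proof.
exists (x + (Num.floor ((u - x) / tau) + 1)%:~R * tau).
  by rewrite -ltrBlDl -ltr_pdivrMr// floorD1_gt.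
move=> t /andP[ut tv]; congr Num.max; apply: floor_def.
rewrite (@le_trans _ _ ((u - x) / tau)) ?floor_le//=.
  by rewrite ltr_pdivrMr// ltrBlDl.
by rewrite ler_pM2r ?invr_gt0// lerB.
Qed.

(** The left limit at [u] of the floor is the ceiling minus one, so stopping slightly before [u]
    costs at most one task. *)
Lemma completed_before (x u : R) :
  exists2 v, v < u & forall t, v <= t ->
    (u - x) / tau <= (completed tau x t)%:~R + 1.
Proof.
pose n := Num.ceil ((u - x) / tau) - 1.
exists (x + n%:~R * tau).
  by rewrite -ltrBrDl -ltr_pdivlMr// ceilB1_lt.
move=> t /completed_ge nt; apply: (le_trans (ceil_ge _)).
by rewrite -(@intrD R _ 1) ler_int -lerBlDr.
Qed.

End completed_tasks.

(** * Existence and measurability of the latency for a general [g] *)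

Section latency.
Context (R : realType) (p m : nat) (tau : R) (g : int -> R).
Hypotheses (tau_gt0 : 0 < tau) (m_gt0 : (0 < m)%N).
Hypotheses (g_homo : {homo g : a b / a <= b}) (g0 : g 0 = 0).
Hypothesis (g_large : m%:R <= p%:R * g m).
Implicit Type x : 'I_p -> R.

(* Ideal load balancing is the case [g n = n], the LT code the case
   [g n = min (alpha * m / p) n]. *)
Definition decodable x : set R :=
  [set t | m%:R <= \sum_(i < p) g (completed tau (x i) t)].

Lemma decodable_up x t u : t <= u -> decodable x t -> decodable x u.
Proof.
move=> tu /le_trans; apply; apply: ler_sum => i _.
by apply: g_homo; apply: completed_homo.
Qed.

Lemma decodable_ge0 x t : (forall i, 0 <= x i) -> decodable x t -> 0 <= t.
Proof.
move=> x0; rewrite /decodable/= leNgt => tm; rewrite leNgt.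
apply: contra tm => t0; rewrite big1 ?ltr0n// => i _.
rewrite -[RHS]g0; congr g; apply/max_idPl.
rewrite floor_le0 ltr_pdivrMr// mul1r.
by have := x0 i; have := tau_gt0; lra.
Qed.

(** The sum of the nonnegative delays dominates each of them, so by this time every worker has
    completed [m] tasks, and [g_large] applies. *)
Lemma decodable_neq0 x : (forall i, 0 <= x i) ->
  decodable x (\sum_i x i + m%:R * tau).
Proof.
move=> x0; apply: (le_trans g_large); rewrite mulr_natl.
rewrite -[X in _ *+ X]card_ord -sumr_const; apply: ler_sum => i _.
apply/g_homo/completed_ge => //; rewrite lerD2r.
by rewrite (bigD1 i)//= lerDl sumr_ge0.
Qed.

Lemma decodable_min x : (forall i, 0 <= x i) ->
  decodable x (minimum (decodable x)) /\
  lbound (decodable x) (minimum (decodable x)).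
Proof.
move=> x0; set A := decodable x.
have A0 : A !=set0 by exists (\sum_i x i + m%:R * tau); exact: decodable_neq0.
have lbA : has_lbound A by exists 0 => t; exact: decodable_ge0.
have lb_inf : lbound A (inf A) by exact: ge_inf.
apply: (@minimumP _ _ (inf A)) => //.
have [v ltv veq] := all_sig2 (fun i =>
  cid2 (completed_rcont _ tau tau_gt0 (x i) (inf A))).
(* No count changes on [[inf A, v0)], and this interval meets [A]; hence [inf A] is itself in [A].
   The seed only has to exceed [inf A]. *)
pose v0 := \big[Num.min/inf A + 1]_i v i.
have v0_gt : inf A < v0.
  by apply: lt_bigmin => [|i _]; rewrite ?ltrDl ?ltr01.
have [|t At] := @inf_adherent R A (v0 - inf A) _ (conj A0 lbA).
  by rewrite subr_gt0.
rewrite addrC subrK => tv.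
move: (At); rewrite /A /decodable/= => /le_trans; apply.
rewrite le_eqVlt; apply/orP; left; apply/eqP; apply: eq_bigr => i _; congr g.
apply: veq; rewrite lb_inf//= (lt_le_trans tv)//.
exact: bigmin_le.
Qed.

Lemma minimum_decodable_le x t : (forall i, 0 <= x i) ->
  (minimum (decodable x) <= t) = (t \in decodable x).
Proof.
move=> x0; have [Amin lbmin] := decodable_min x x0.
apply/idP/idP => [h|]; first by rewrite inE; exact: decodable_up h Amin.
by rewrite inE; exact: lbmin.
Qed.

(** Decodable times form a closed up-ray, so the latency is at most [t] exactly when decoding is
    possible at the fixed time [t]. That event involves only a sum of monotone functions of the
    delays. *)
Lemma measurable_minimum_decodable d (T : measurableType d)
    (X : 'I_p -> T -> R) :
  (forall i, measurable_fun setT (X i)) -> (forall i w, 0 <= X i w) ->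
  measurable_fun setT (fun w => minimum (decodable (X^~ w))).
Proof.
move=> mX X0; apply: measurable_fun_sublevel => t.
have -> : [set w | minimum (decodable (X^~ w)) <= t] =
    setT `&` [set w | m%:R <= \sum_(i < p) g (completed tau (X i w) t)].
  rewrite setTI; apply/seteqP; split=> w /=;
    by rewrite minimum_decodable_le// inE.
apply: measurable_fun_le => //; apply: measurable_sum => i.
apply: (measurableT_comp (f := fun y => g (completed tau y t))) => //.
apply: nonincreasing_measurable => // a b ab.
by apply: g_homo; exact: completed_homo.
Qed.

End latency.

(** * The two latencies for a fixed realization of the delays *)

Lemma T_idealE (R : realType) (p m : nat) (tau : R) (x : 'I_p -> R) :
  T_ideal tau m x = minimum (decodable R p m tau intr x).
Proof.
congr minimum; apply/seteqP; split=> t;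
  by rewrite /decodable/= -rmorph_sum/= -(ler_int R).
Qed.

(* Just before the first decodable time [t], a worker of delay [y] has completed
   at least [(t - y) / tau - 1] tasks; if all delays were close to [x i], these
   bounds would already add up to [m]. *)
Lemma late_worker (R : realType) (p m : nat) (tau c t : R) (x : 'I_p -> R)
    (i : 'I_p) :
  (2 <= p)%N -> 0 < tau -> lbound (decodable R p m tau intr x) t ->
  x i + (c + 1) * tau <= t ->
  exists j, tau * (p%:R * c - m%:R) / (p%:R - 1) <= x j - x i.
Proof.
move=> p_ge2 tau_gt0 lbt xit; set D := _ / _.
have p1_gt0 : 0 < p%:R - 1 :> R by rewrite subr_gt0 ltr1n.
apply: contrapT => /forallNP near_i.
have [v ltv vN] := all_sig2 (fun j =>
  cid2 (completed_before _ tau tau_gt0 (x j) t)).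
(* One time before [t] at which the bounds for all workers hold; the seed only has to lie below
   [t]. *)
pose u := \big[Num.max/t - 1]_j v j.
have ut : u < t by apply: bigmax_lt => [|j _]; rewrite ?gtrBl ?ltr01.
have uN j : (t - x j) / tau <= (completed tau (x j) u)%:~R + 1.
  exact/vN/le_bigmax.
have: ~~ (m%:R <= \sum_j (completed tau (x j) u)%:~R :> R).
  by apply/negP => /lbt; rewrite leNgt ut.
apply/negP; rewrite negbK (bigD1 i)//=.
have iN : c <= (completed tau (x i) u)%:~R.
  rewrite -(lerD2r 1) (le_trans _ (uN i))// ler_pdivlMr//; lra.
have jN j : c - D / tau <= (completed tau (x j) u)%:~R.
  rewrite -(lerD2r 1) (le_trans _ (uN j))// ler_pdivlMr//.
  rewrite mulrDl mulrBl divfK ?gt_eqF//.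
  by have /negP := near_i j; rewrite -ltNge; lra.
(* [D] is chosen so that [c + (p - 1) (c - D / tau) = m]. *)
apply: (@le_trans _ _ (c + \sum_(j < p | j != i) (c - D / tau))); last first.
  by rewrite lerD// ler_sum.
rewrite sumr_const cardC1 card_ord -[_ *+ p.-1]mulr_natr -subn1.
rewrite natrB ?(ltnW p_ge2)//.
rewrite le_eqVlt; apply/orP; left; apply/eqP; rewrite /D.
by field; rewrite !gt_eqF.
Qed.

Section cap.
Context (R : realType) (p m : nat) (alpha : R).
Hypotheses (p_gt0 : (0 < p)%N) (alpha_gt1 : 1 < alpha).

Definition cap (n : int) : R := Num.min (alpha * m%:R / p%:R) n%:~R.

Lemma cap_homo : {homo cap : a b / a <= b}.
Proof. by move=> a b ab; rewrite /cap le_min !ge_min lexx ler_int ab orbT. Qed.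

Lemma cap0 : cap 0 = 0.
Proof. by apply/min_idPr; rewrite divr_ge0// mulr_ge0// ltW// (lt_trans ltr01). Qed.

(** Both arguments of the minimum are at least [m / p]: the first because [1 < alpha], the second
    because [1 <= p]. *)
Lemma cap_large : m%:R <= p%:R * cap m.
Proof.
have p0 : 0 < p%:R :> R by rewrite ltr0n.
rewrite mulrC -ler_pdivrMr// le_min ler_pM2r ?invr_gt0//.
rewrite ler_peMl ?(ltW alpha_gt1)//=.
by rewrite ler_pdivrMr// ler_peMr// ler1n.
Qed.

End cap.

Lemma intr_homo (R : realType) : {homo (intr : int -> R) : a b / a <= b}.
Proof. by move=> a b; rewrite ler_int. Qed.

Lemma intr_large (R : realType) (p m : nat) :
  (0 < p)%N -> m%:R <= p%:R * m%:~R :> R.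
Proof. by move=> p0; rewrite ler_peMl// ler1n. Qed.

Lemma latency_gap_spread (R : realType) (p m : nat) (tau alpha : R)
    (x : 'I_p -> R) :
  (2 <= p)%N -> (1 <= m)%N -> 0 < tau -> 1 < alpha ->
  alpha * m%:R / p%:R \is a Num.int -> (forall i, 0 <= x i) ->
  T_ideal tau m x < T_LT tau alpha m x ->
  exists ij : 'I_p * 'I_p,
    tau * m%:R * (alpha - 1) / (p%:R - 1) <= x ij.2 - x ij.1.
Proof.
move=> p_ge2 m_gt0 tau_gt0 alpha_gt1 /intrP[c cE] x0.
have p_gt0 : (0 < p)%N by rewrite ltnW.
have p0 : 0 < p%:R :> R by rewrite ltr0n.
have c_ge0 : 0 <= c.
  by rewrite -(ler_int R) -cE divr_ge0// mulr_ge0// ltW// (lt_trans ltr01).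
rewrite T_idealE; have [tmin tlb] := decodable_min R p m tau intr tau_gt0 m_gt0
  (intr_homo R) (mulr0z 1) (intr_large R p m p_gt0) x x0.
set t := minimum _ in tmin tlb *.
have -> : T_LT tau alpha m x =
  minimum (decodable R p m tau (cap R p m alpha) x) by [].
rewrite ltNge minimum_decodable_le ?cap0 ?cap_large//; last exact: cap_homo.
move=> /negP; rewrite inE => tN.
(* Otherwise no cap is active at [t], and the LT code decodes there too. *)
have [i ci] : exists i, c < completed tau (x i) t.
  apply: contrapT => /forallNP cN; apply: tN; move: tmin.
  rewrite /decodable/=; congr (_ <= _); apply: eq_bigr => j _.
  by apply/esym/min_idPr; rewrite cE ler_int leNgt; apply/negP.
(* As [c] is an integer, more than [c] tasks means at least [c + 1]. *)
have [|j jE] := late_worker R p m tau c%:~R t x i p_ge2 tau_gt0 tlb.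
  rewrite -(intrD R c 1); apply: completed_le => //; last by rewrite -lezD1 in ci.
  by rewrite ltzD1.
exists (i, j); apply: le_trans jE; rewrite -cE le_eqVlt; apply/orP; left.
by apply/eqP; field; rewrite !gt_eqF// subr_gt0 ltr1n.
Qed.

(** * Spacings and the range of the delays *)

Lemma sum_spacing (R : realType) (p : nat) (x : 'I_p -> R) : (0 < p)%N ->
  exists ij : 'I_p * 'I_p, \sum_(1 <= l < p) spacing x l = x ij.2 - x ij.1.
Proof.
(* What remains is the last minus the first entry of the sorted list, and each entry is some
   [x i]. *)
move=> p0; rewrite (telescope_sumr (order_stat x))//.
have orderE k : (k.-1 < p)%N -> exists i, order_stat x k = x i.
  move=> kp; have : order_stat x k \in [seq x i | i : 'I_p].
    by rewrite -(mem_sort <=%R) mem_nth// size_sort size_map size_enum_ord.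
  by case/mapP => i _; exists i.
have [|j ->] := orderE p; first by rewrite prednK.
by have [//|i ->] := orderE 1%N; exists (i, j).
Qed.

Lemma sum_spacing_ge (R : realType) (p : nat) (x : 'I_p -> R) (i j : 'I_p) :
  x j - x i <= \sum_(1 <= l < p) spacing x l.
Proof.
have p0 : (0 < p)%N by case: p i {x j} => // -[].
rewrite (telescope_sumr (order_stat x))//.
have sz : size (sort <=%R [seq x i | i : 'I_p]) = p.
  by rewrite size_sort size_map size_enum_ord.
have xE k : exists2 n, (n < p)%N & x k = nth 0 (sort <=%R [seq x i | i : 'I_p]) n.
  have : x k \in sort <=%R [seq x i | i : 'I_p] by rewrite mem_sort map_f ?mem_enum.
  by move=> /(nthP 0)[n]; rewrite sz => np <-; exists n.
have [[a ap ->] [b bp ->]] := (xE j, xE i).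
by apply: lerB; apply: le_sorted_leq_nth;
  rewrite ?sort_le_sorted// ?inE ?sz ?prednK// -ltnS prednK.
Qed.

Theorem theorem3 (d : measure_display) (T : measurableType d) (R : realType)
    (P : probability T R) (p m : nat) (tau alpha : R)
    (X : 'I_p -> {RV P >-> R})
    (hp : (2 <= p)%N) (hm : (1 <= m)%N) (htau : 0 < tau) (halpha : 1 < alpha)
    (hint : alpha * m%:R / p%:R \is a Num.int)
    (hX0 : forall i w, 0 <= X i w)
    (hX : iid X) :
  (P [set w | (T_ideal tau m (fun i => X i w)
               < T_LT tau alpha m (fun i => X i w))%R]
   <= \sum_(2 <= j < p.+1)
        P [set w | (tau * m%:R * (alpha - 1) / (p%:R - 1)
                    <= \sum_(1 <= l < j) spacing (fun i => X i w) l)%R])%E.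
Proof.
pose delta := tau * m%:R * (alpha - 1) / (p%:R - 1).
have p_gt0 : (0 < p)%N by rewrite ltnW.
(* The event of the term [j = p] contains those of all the others and suffices. *)
pose spread := [set w | delta <= \sum_(1 <= l < p) spacing (X^~ w) l].
(* As a finite union over pairs of workers, the event is measurable without any study of sorting as
   a function of the sample point. *)
have spreadE : spread =
    \bigcup_(ij in [set: 'I_p * 'I_p])
      (setT `&` [set w | delta <= X ij.2 w - X ij.1 w]).
  apply/seteqP; split=> w /=.
    have [ij sumE] := sum_spacing _ _ (X^~ w) p_gt0.
    by rewrite /spread/= sumE => h; exists ij.
  by case=> ij _ [_ /= h]; apply: (le_trans h); exact: sum_spacing_ge.
have mspread : measurable spread.
  rewrite spreadE; apply: fin_bigcup_measurable => [|ij _].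
    exact: finite_finset.
  by apply: measurable_fun_le => //; apply: measurable_funB.
have mgap :
    measurable [set w | T_ideal tau m (X^~ w) < T_LT tau alpha m (X^~ w)].
  have -> : [set w | T_ideal tau m (X^~ w) < T_LT tau alpha m (X^~ w)] =
      setT `&` (fun w => T_ideal tau m (X^~ w) < T_LT tau alpha m (X^~ w))
                 @^-1` [set true].
    by rewrite setTI; apply/seteqP; split.
  apply: measurable_fun_ltr => //.
    under eq_fun do rewrite T_idealE.
    by apply: measurable_minimum_decodable => //; [exact: intr_homo|exact: intr_large].
  apply: (measurable_minimum_decodable R p m tau (cap R p m alpha)) => //;
    [exact: cap_homo|exact: cap0|exact: cap_large].
rewrite big_nat_recr//=; apply: (@le_trans _ _ (P spread)).
  apply: le_measure; rewrite ?inE// => w /= gap.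
  have [ij h] := latency_gap_spread _ _ _ _ _ _ hp hm htau halpha hint (hX0^~ w) gap.
  exact: le_trans h (sum_spacing_ge _ _ _ _ _).
by apply: leeDr; apply: sume_ge0.
Qed.
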